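(* Let $n$ be a positive integer. Assume that $K_n(\lambda)\ge 0$ for every $\lambda\in\mathbb{R}_+^n$ satisfying $0<\|\lambda\|_2^2<n$. Then there is no pair $(\lambda,\nu)\in\mathbb{R}^n\times\mathbb{R}^n$ satisfying the system $$\begin{cases}4\Psi(n)\lambda-\frac4n\big(\lambda_0\log\lambda_0,\dots,\lambda_{n-1}\log\lambda_{n-1}\big)^{\mathrm T}-\nu=0,\\ 0<\|\lambda\|_2^2<n,\\ \lambda_j\ge0,\quad \lambda_j\nu_j=0,\quad \nu_j\ge 0\qquad(0\le j\le n-1).\end{cases}$$ Consequently, $\mathrm{H}_n[\lambda]\le 2\langle\lambda,\Psi(n)\lambda\rangle$ for every nonzero $\lambda\in\mathbb{R}_+^n$.
   Context: $\mathbb{R}_+=[0,\infty)$; vectors in $\mathbb{R}^n$ are columns indexed by $0,\dots,n-1$ (indices modulo $n$), $\langle\cdot,\cdot\rangle$ and $\|\cdot\|_2$ are the standard (unnormalized) Euclidean inner product and norm, and $0\log0=0$. Let $\omega=e^{2\pi i/n}$, $F_n=(\omega^{jk})_{0\le j,k\le n-1}$, $\psi_n(k)=\min(k,n-k)$, and $$\Psi(n)=\frac1nF_n\,\mathrm{diag}(\psi_n(0),\dots,\psi_n(n-1))\,F_n^{-1},$$ which is a real symmetric matrix. Let $S_n$ be the cyclic shift, $(S_n\lambda)_i=\lambda_{i+1}$, and $L=2I-S_n-S_n^{\mathrm T}$, so $(L\lambda)_i=2\lambda_i-\lambda_{i+1}-\lambda_{i-1}$. Write $\lambda^2=(\lambda_0^2,\dots,\lambda_{n-1}^2)^{\mathrm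 T}$. Define $K_n:\mathbb{R}_+^n\to\mathbb{R}$ by $$K_n(\lambda)=4\langle\lambda,L\Psi(n)\lambda\rangle-\frac2n\langle\lambda^2,L\lambda\rangle.$$ For nonzero $\lambda\in\mathbb{R}_+^n$ define the entropy $$\mathrm{H}_n[\lambda]=\frac1n\sum_{k=0}^{n-1}\lambda_k^2\log(\lambda_k^2)-\frac{\|\lambda\|_2^2}{n}\log\Big(\frac{\|\lambda\|_2^2}{n}\Big).$$ *)

(* Defs.v *)
From mathcomp Require Import all_boot all_order all_algebra.
From mathcomp Require Import reals sequences exp trigo.
From mathcomp Require Import complex.
From mathcomp Require Import ring lra.

Set Implicit Arguments.
Unset Strict Implicit.
Unset Printing Implicit Defensive.

Import Order.TTheory GRing.Theory Num.Theory.
Local Open Scope ring_scope.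

Definition dot (R : realType) (n : nat) (x y : 'cV[R]_n) : R :=
  \sum_(i < n) x i 0 * y i 0.

Definition norm2 (R : realType) (n : nat) (x : 'cV[R]_n) : R :=
  Num.sqrt (dot x x).

(* Euler's formula is taken as the definition of e^{it}. *)
Definition expi (R : realType) (t : R) : R[i] := (cos t +i* sin t)%C.

Definition omega (R : realType) (n : nat) : R[i] := expi (2 * pi / n%:R : R).

Definition fourier_mx (R : realType) (n : nat) : 'M[R[i]]_n :=
  \matrix_(j, k) omega R n ^+ (j * k).

Definition psi (n k : nat) : nat := minn k (n - k).

Definition PsiC (R : realType) (n : nat) : 'M[R[i]]_n :=
  n%:R^-1 *: (fourier_mx R n *m diag_mx (\row_k (psi n k)%:R)
                *m invmx (fourier_mx R n)).

(* [PsiC R n] has real entries (see [PsiC_real] below), so taking real parts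
   only changes the type. *)
Definition Psi (R : realType) (n : nat) : 'M[R]_n :=
  map_mx (@complex.Re R) (PsiC R n).

(* [ordS] is the successor modulo [n], so (shift_mx *m x)_i = x_{i+1}. *)
Definition shift_mx (R : realType) (n : nat) : 'M[R]_n :=
  \matrix_(i, j) (j == ordS i)%:R.

Definition lap (R : realType) (n : nat) : 'M[R]_n :=
  2%:M - shift_mx R n - (shift_mx R n)^T.

Definition sqv (R : realType) (n : nat) (x : 'cV[R]_n) : 'cV[R]_n :=
  \col_i x i 0 ^+ 2.

Definition nonneg (R : realType) (n : nat) (x : 'cV[R]_n) : Prop :=
  forall i : 'I_n, 0 <= x i 0.

Definition K (R : realType) (n : nat) (x : 'cV[R]_n) : R :=
  4 * dot x (lap R n *m Psi R n *m x) - 2 / n%:R * dot (sqv x) (lap R n *m x).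

(* The convention 0 log 0 = 0 is automatic, [ln] being total. *)
Definition entropy (R : realType) (n : nat) (x : 'cV[R]_n) : R :=
  n%:R^-1 * (\sum_(k < n) x k 0 ^+ 2 * ln (x k 0 ^+ 2))
  - norm2 x ^+ 2 / n%:R * ln (norm2 x ^+ 2 / n%:R).

Lemma shift_mxE (R : realType) (n : nat) (x : 'cV[R]_n) (i : 'I_n) :
  (shift_mx R n *m x) i 0 = x (ordS i) 0.
Proof.
rewrite mxE (bigD1 (ordS i)) //= mxE eqxx mul1r big1 ?addr0 // => j /negPf ne.
by rewrite mxE ne mul0r.
Qed.

Lemma lapE (R : realType) (n : nat) (x : 'cV[R]_n) (i : 'I_n) :
  (lap R n *m x) i 0 = 2 * x i 0 - x (ordS i) 0 - x (ord_pred i) 0.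
Proof.
rewrite /lap !mulmxBl mul_scalar_mx.
have mxB (A B : 'cV[R]_n) : (A - B) i 0 = A i 0 - B i 0 by rewrite !mxE.
rewrite !mxB shift_mxE mxE; congr (_ - _ - _).
rewrite mxE (bigD1 (ord_pred i)) //= !mxE ord_predK eqxx mul1r.
rewrite big1 ?addr0 // => j ne; rewrite !mxE.
case: eqP => [eij|]; last by rewrite mul0r.
by rewrite eij ordSK eqxx in ne.
Qed.

Lemma expiD (R : realType) (s t : R) : expi (s + t) = expi s * expi t.
Proof. by rewrite /expi cosD sinD /GRing.mul /= [sin s * _ + _]addrC. Qed.

Lemma expi_conj (R : realType) (t : R) : expi t * conjc (expi t) = 1.
Proof.
apply/eqP; rewrite /expi /GRing.mul eq_complex /=.
by rewrite mulrN opprK -!expr2 cos2Dsin2 eqxx mulrN [sin t * _]mulrC addNr eqxx.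
Qed.

Lemma omega_neq0 (R : realType) (n : nat) : omega R n != 0.
Proof.
apply: contraNneq (oner_neq0 R[i]) => w0.
by rewrite -(expi_conj (2 * pi / n%:R : R)) -/(omega R n) w0 mul0r.
Qed.

Lemma omegaX (R : realType) (n k : nat) :
  omega R n ^+ k = expi (k%:R * (2 * pi / n%:R : R)).
Proof.
elim: k => [|k IHk].
  by apply/eqP; rewrite mul0r expr0 /expi cos0 sin0 eq_complex /= !eqxx.
by rewrite exprSr IHk -expiD -[k.+1%:R]natr1 (mulrDl k%:R) mul1r.
Qed.

Lemma omega_prim (R : realType) (n : nat) :
  (0 < n)%N -> n.-primitive_root (omega R n).
Proof.
move=> n0; have nR : (0 : R) < n%:R by rewrite ltr0n.
rewrite /primitive_root_of_unity n0; apply/forallP => i; apply/eqP.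
rewrite unity_rootE; have [->|ne] := eqVneq i.+1 n.
  have -> : omega R n ^+ n = expi (pi *+ 2).
    by rewrite omegaX -(mulr_natl pi); congr expi; field; rewrite gt_eqF.
  by rewrite /expi cos2pi sin2pi !eqxx.
apply/negP => /eqP; rewrite omegaX => -[+ _].
have y0 : 0 < i.+1%:R * (pi / n%:R) :> R.
  by rewrite mulr_gt0 ?divr_gt0 ?pi_gt0 ?ltr0n.
have y1 : i.+1%:R * (pi / n%:R) < pi :> R.
  rewrite mulrCA gtr_pMr ?pi_gt0 // ltr_pdivrMr // mul1r ltr_nat.
  by rewrite ltn_neqAle ne ltn_ord.
have -> : i.+1%:R * (2 * pi / n%:R) = i.+1%:R * (pi / n%:R) *+ 2 :> R.
  by rewrite -mulr_natl; ring.
rewrite cos_mulr2n.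
have /eqP := cos2Dsin2 (i.+1%:R * (pi / n%:R) : R).
have : 0 < sin (i.+1%:R * (pi / n%:R)) :> R by rewrite sin_gt0_pi // y0 y1.
by move=> + /eqP + +; nra.
Qed.

Definition fourier_inv (R : realType) (n : nat) : 'M[R[i]]_n :=
  n%:R^-1 *: \matrix_(j, k) (omega R n)^-1 ^+ (j * k).

Lemma fourier_mulV (R : realType) (n : nat) :
  fourier_mx R n *m fourier_inv R n = 1%:M.
Proof.
case: n => [|m]; first by apply/matrixP => -[].
set n := m.+1; have pr := omega_prim R (ltn0Sn m).
rewrite -/n in pr; set w := omega R n in pr *.
have nz : n%:R != 0 :> R[i] by rewrite pnatr_eq0.
have w0 : w != 0 by exact: omega_neq0.
rewrite -scalemxAr; apply/matrixP => j k; rewrite !mxE.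
have -> : \sum_(l < n) fourier_mx R n j l *
      (\matrix_(j0, k0) w^-1 ^+ (j0 * k0)) l k
    = \sum_(l < n) (w ^+ j / w ^+ k) ^+ l.
  apply: eq_bigr => l _; rewrite !mxE -/w exprMn -[w ^- k]exprVn -!exprM.
  by rewrite [(l * k)%N]mulnC.
have [<-|ne] := eqVneq j k.
  rewrite divff ?expf_neq0 //; under eq_bigr do rewrite expr1n.
  by rewrite sumr_const card_ord mulVf.
have z1 : w ^+ j / w ^+ k - 1 != 0.
  rewrite subr_eq0; apply: contra ne => /eqP e.
  have /eqP : w ^+ j = w ^+ k by rewrite -[LHS](divfK (expf_neq0 k w0)) e mul1r.
  by rewrite (eq_prim_root_expr pr) !modn_small // => /eqP/val_inj->.
suff -> : \sum_(l < n) (w ^+ j / w ^+ k) ^+ l = 0 by rewrite mulr0.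
apply: (mulfI z1); rewrite -subrX1 mulr0 exprMn exprVn -!exprM.
by rewrite ![(_ * n)%N]mulnC !exprM (prim_expr_order pr) !expr1n divr1 subrr.
Qed.

Lemma fourier_unit (R : realType) (n : nat) : fourier_mx R n \in unitmx.
Proof. by case: (mulmx1_unit (fourier_mulV R n)). Qed.

Lemma fourier_invE (R : realType) (n : nat) :
  invmx (fourier_mx R n) = fourier_inv R n.
Proof.
by rewrite -[LHS]mulmx1 -(fourier_mulV R n) mulKmx // fourier_unit.
Qed.

Lemma PsiCE (R : realType) (n : nat) (j k : 'I_n) :
  PsiC R n j k = n%:R^-1 ^+ 2 *
    \sum_(l < n) omega R n ^+ (j * l) * (psi n l)%:R * (omega R n)^-1 ^+ (l * k).
Proof.
rewrite /PsiC fourier_invE -scalemxAr scalerA mxE -expr2 mxE; congr (_ * _).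
by apply: eq_bigr => l _; rewrite mul_mx_diag !mxE.
Qed.

Lemma PsiC_sym (R : realType) (n : nat) : (PsiC R n)^T = PsiC R n.
Proof.
apply/matrixP => j k; rewrite mxE !PsiCE; congr (_ * _).
have n0 : (0 < n)%N by apply: leq_ltn_trans (ltn_ord j).
have pr := omega_prim R n0; set w := omega R n in pr *.
have w0 : w != 0 by exact: omega_neq0.
pose opp (l : 'I_n) : 'I_n := Ordinal (ltn_pmod (n - l) n0).
have oppE l : opp l = (if l == 0%N :> nat then 0 else n - l)%N :> nat.
  rewrite /=; case: eqP => [->|/eqP l0]; first by rewrite subn0 modnn.
  by rewrite modn_small // ltn_subrL n0 lt0n l0.
have oppK : involutive opp.
  move=> l; apply/ord_inj; rewrite oppE.
  move: (opp l) (oppE l) => m ->; case: (eqVneq (l : nat) 0%N) => [-> //|l0].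
  by rewrite subn_eq0 leqNgt ltn_ord /= subKn // ltnW.
rewrite (reindex_inj (inv_inj oppK)); apply: eq_bigr => l _.
have wopp : w ^+ opp l = w ^- l.
  apply: (mulIf (expf_neq0 l w0)); rewrite mulVf ?expf_neq0 //.
  rewrite /= prim_expr_mod // -exprD subnK ?prim_expr_order //.
  by rewrite ltnW.
have psiopp : psi n (opp l) = psi n l.
  rewrite /psi oppE; case: eqP => [->|_]; first by rewrite !min0n.
  by rewrite subKn 1?minnC // ltnW.
rewrite psiopp mulrAC [RHS]mulrAC; congr (_ * _).
rewrite mulrC; congr (_ * _).
  by rewrite exprM exprVn wopp invrK -exprM mulnC.
by rewrite mulnC exprM wopp -exprVn -exprM.
Qed.

Lemma PsiC_real (R : realType) (n : nat) :
  map_mx (real_complex R) (Psi R n) = PsiC R n.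
Proof.
apply/matrixP => j k; rewrite mxE [Psi R n j k]mxE.
suff : conjc (PsiC R n j k) = PsiC R n j k.
  case: (PsiC R n j k) => a b [] e; have -> // : b = 0 by lra.
have e : PsiC R n j k = PsiC R n k j by rewrite -[in LHS]PsiC_sym mxE.
rewrite [RHS]e !PsiCE => {e}.
have wc : conjc (omega R n) = (omega R n)^-1.
  apply: (mulfI (omega_neq0 R n)); rewrite divff ?omega_neq0 //.
  exact: expi_conj.
rewrite rmorphM rmorphXn fmorphV rmorph_nat rmorph_sum; congr (_ * _).
apply: eq_bigr => l _.
have cM (x y : R[i]) : conjc (x * y) = conjc x * conjc y by exact: rmorphM.
have cX (x : R[i]) m : conjc (x ^+ m) = conjc x ^+ m by exact: rmorphXn.
rewrite /= !cM !cX conjc_inv conjc_nat wc invrK.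
by rewrite [LHS]mulrC [(l * k)%N]mulnC [(l * j)%N]mulnC [RHS]mulrAC mulrA.
Qed.

Lemma Psi_sym (R : realType) (n : nat) : (Psi R n)^T = Psi R n.
Proof.
apply/matrixP => j k; rewrite mxE [LHS]mxE [RHS]mxE; congr complex.Re.
by rewrite -[in LHS]PsiC_sym mxE.
Qed.

(* Main.v *)
Require Import Defs.
From mathcomp Require Import all_boot all_order all_algebra.
From mathcomp Require Import boolp classical_sets reals topology normedtype.
From mathcomp Require Import derive realfun sequences exp.
From mathcomp Require Import complex.
From mathcomp Require Import ring lra.

Set Implicit Arguments.
Unset Strict Implicit.
Unset Printing Implicit Defensive.

Import Order.TTheory GRing.Theory Num.Theory.
Import numFieldNormedType.Exports.
Local Open Scope classical_set_scope.
Local Open Scope ring_scope.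

(* Pairing the system with L x turns K x into (2/n) <g(x), L x> + <v, L x> with
   g(t) = 2 t ln t - t^2.  The second term is nonpositive by complementary
   slackness, and summation by parts makes the first one nonpositive, since g is
   strictly decreasing on [0, +oo[; so K x >= 0 forces x to be a constant c with
   0 < c < 1.  But Psi kills constants, and the system then reads c ln c = 0.

   If the entropy inequality failed, a minimiser of
   2n <y, Psi y> - sum_i y_i^2 ln y_i^2 on the sphere |y|^2 = n in the orthant
   would, after rescaling, minimise over the whole orthant a function whose
   first-order conditions are precisely the system. *)

(** * The functions u ln u and 2 u ln u - u^2 *)

(* [ln] vanishes on ]-oo, 0], hence continuity on the whole line. *)
Lemma xlnx_continuous (R : realType) : continuous (fun u : R => u * ln u).
Proof.
move=> u; have [u_lt0|u_gt0|->] := ltgtP u 0.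
- apply: cvg_near_cst; near=> t.
  have t_lt0 : t < 0 by near: t; exact: lt_nbhsl.
  by rewrite !ln0 ?mulr0 ?ltW.
- by apply: cvgM; [exact: cvg_id | exact: continuous_ln].
rewrite /continuous_at mul0r; apply/cvgr0Pnorm_le => e e_gt0.
(* For 0 < t < 1 and s = sqrt t, the bound - ln s < 1/s gives |t ln t| <= 2 s, so the limit at 0
   follows from that of the square root. *)
have: (fun t : R => Num.sqrt `|t|) @ 0 --> Num.sqrt `|0 : R|.
  apply: (@continuous_comp _ _ _ (fun t : R => `|t|) Num.sqrt).
    exact: norm_continuous.
  exact: sqrt_continuous.
have e2_gt0 : 0 < e / 2 by rewrite divr_gt0.
rewrite normr0 sqrtr0 => /cvgr0Pnorm_le /(_ _ e2_gt0) => sq.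
near=> t.
have t_lt1 : t < 1 by near: t; apply: lt_nbhsl.
have : `|Num.sqrt `|t| | <= e / 2 by near: t.
have [t_le0 _|t_gt0] := leP t 0; first by rewrite ln0 // mulr0 normr0 ltW.
rewrite (gtr0_norm t_gt0) (ger0_norm (sqrtr_ge0 t)).
have s_gt0 : 0 < Num.sqrt t by rewrite sqrtr_gt0.
rewrite normrM (gtr0_norm t_gt0) (ler0_norm (ln_le0 (ltW t_lt1))).
rewrite -{2 3}(sqr_sqrtr (ltW t_gt0)); set s := Num.sqrt t in s_gt0 *.
rewrite lnXn // => s_le.
have : s^-1 > - ln s by rewrite -lnV ?posrE // ln_sublinear ?invr_gt0.
rewrite -(ltr_pM2l (exprn_gt0 2 s_gt0)) [_ * s^-1]mulrC expr2 mulrA.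
rewrite mulVf ?gt_eqF //.
by lra.
Unshelve. all: by end_near. Qed.

(** Convexity of u ln u, from ln y <= y - 1 at y = u0 / u; it stands in for a derivative in the
    first-order conditions. *)
Lemma xlnx_tangent (R : realType) (u u0 : R) : 0 <= u -> 0 < u0 ->
  u0 * ln u0 + (1 + ln u0) * (u - u0) <= u * ln u.
Proof.
rewrite le_eqVlt => /orP[/eqP <-|u_gt0] u0_gt0; first by lra.
have h : ln (u0 / u) <= u0 / u - 1.
  rewrite -[X in ln X](subrKC 1) le_ln1Dx // ltrBrDl subrr divr_gt0 //.
move: h; rewrite ln_div ?posrE // -(ler_pM2l u_gt0) mulrBr mulrBr.
rewrite mulrCA divff ?gt_eqF //.
by lra.
Qed.

(** The derivative 2 (ln t + 1 - t) is negative on ]0, +oo[ except at t = 1, where it vanishes. *)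
Lemma xlnx_sub_sqr_decr (R : realType) (a b : R) : 0 <= a -> a < b ->
  2 * (b * ln b) - b ^+ 2 < 2 * (a * ln a) - a ^+ 2.
Proof.
pose g (t : R) := 2 * (t * ln t) - t ^+ 2; rewrite -/(g a) -/(g b).
have gc : continuous g.
  move=> t; apply: cvgB.
    by apply: cvgM; [exact: cvg_cst | exact: xlnx_continuous].
  exact: exprn_continuous.
have dg (t : R) : 0 < t -> is_derive t 1 g (2 * (ln t + 1 - t)).
  move=> t_gt0; have dl := is_derive1_ln t_gt0.
  apply: is_derive_eq; rewrite /GRing.scale /= mulfV ?gt_eqF //; ring.
have dg_lt0 (t : R) : 0 < t -> t != 1 -> derive1 g t < 0.
  move=> t_gt0 t_neq1; rewrite derive1E.
  rewrite (@derive_val _ _ _ _ _ _ _ (dg t t_gt0)).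
  suff : ln t < t - 1 by lra.
  have l_neq0 : ln t != 0 by rewrite ln_eq0.
  by have := expR_gt1Dx l_neq0; rewrite lnK ?posrE //; lra.
(* Here 1 is kept out of the interior of the interval; an interval around 1 is split there
   afterwards. *)
have decr (c d : R) : 0 <= c -> (d <= 1) || (1 <= c) -> c < d -> g d < g c.
  move=> c_ge0 cd1 cd.
  apply: (@ltr0_derive1_lt_cc _ g c d); rewrite ?in_itv /= ?lexx ?(ltW cd) //.
  - move=> t; rewrite in_itv /= => /andP[ct td].
    have [//] := dg t (le_lt_trans c_ge0 ct).
  - move=> t; rewrite in_itv /= => /andP[ct td].
    apply: dg_lt0; first exact: le_lt_trans ct.
    by apply/eqP => t1; move: cd1 ct td; rewrite t1; case/orP => ? ? ?; lra.
  - exact: continuous_subspaceT.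
move=> a_ge0 ab; have [b1|b1] := leP b 1; first by apply: decr; rewrite ?b1.
have [a1|a1] := leP 1 a; first by apply: decr; rewrite ?a1 ?orbT.
by apply: (@lt_trans _ _ (g 1)); apply: decr; rewrite ?lexx ?orbT.
Qed.

(** * Inner product, cyclic Laplacian and summation by parts *)

Lemma dotE (R : realType) (n : nat) (x y : 'cV[R]_n) :
  dot x y = (x^T *m y) 0 0.
Proof. by rewrite mxE; apply: eq_bigr => i _; rewrite mxE. Qed.

Lemma dotC (R : realType) (n : nat) (x y : 'cV[R]_n) : dot x y = dot y x.
Proof. by apply: eq_bigr => i _; rewrite mulrC. Qed.

Lemma dot_mulmxr (R : realType) (n : nat) (A : 'M[R]_n) (x y : 'cV[R]_n) :
  dot x (A *m y) = dot (A^T *m x) y.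
Proof. by rewrite !dotE trmx_mul trmxK mulmxA. Qed.

Lemma lap_sym (R : realType) (n : nat) : (lap R n)^T = lap R n.
Proof. by rewrite /lap !linearB /= trmxK tr_scalar_mx addrAC. Qed.

(** A cyclic shift of the index turns the backward differences into forward ones. For decreasing f
    every term on the right is nonpositive. *)
Lemma sum_mul_lap (R : realType) (n : nat) (f : R -> R) (x : 'cV[R]_n) :
  \sum_(i < n) f (x i 0) * (lap R n *m x) i 0 =
  \sum_(i < n) (f (x i 0) - f (x (ordS i) 0)) * (x i 0 - x (ordS i) 0).
Proof.
have e : \sum_(i < n) f (x i 0) * (x i 0 - x (ord_pred i) 0)
       = \sum_(i < n) f (x (ordS i) 0) * (x (ordS i) 0 - x i 0).
  rewrite (reindex_inj (can_inj (@ordSK n))); apply: eq_bigr => i _.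
  by rewrite ordSK.
transitivity (\sum_(i < n) f (x i 0) * (x i 0 - x (ordS i) 0)
            + \sum_(i < n) f (x i 0) * (x i 0 - x (ord_pred i) 0)).
  by rewrite -big_split; apply: eq_bigr => i _; rewrite lapE /=; ring.
by rewrite e -big_split; apply: eq_bigr => i _ /=; ring.
Qed.

Lemma ordS_invariant (T : Type) (n : nat) (f : 'I_n -> T) :
  (forall i, f (ordS i) = f i) -> forall i j, f i = f j.
Proof.
move=> fS i j.
have f0 (k : 'I_n) : f k = f (Ordinal (leq_ltn_trans (leq0n k) (ltn_ord k))).
  case: k => k; elim: k => [|k IHk] kn.
    by congr f; apply/val_inj.
  (* Below n the cyclic successor does not wrap around, so every index is reached from 0. *)
  rewrite (_ : Ordinal kn = ordS (Ordinal (ltnW kn))).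
    by rewrite fS IHk; congr f; apply/val_inj.
  by apply/val_inj; rewrite /= modn_small.
by rewrite f0 [RHS]f0; congr f; apply/val_inj.
Qed.

(* The constant vector is the Fourier mode 0, and psi vanishes there. *)
Lemma Psi_const (R : realType) (n : nat) (c : R) :
  Psi R n *m const_mx c = 0 :> 'cV_n.
Proof.
case: n => [|m]; first by apply/matrixP => -[].
suff P1 : PsiC R m.+1 *m const_mx 1 = 0 :> 'cV_m.+1.
  apply: (@map_mx_inj _ _ (real_complex R)).
  rewrite map_mxM PsiC_real map_mx0 map_const_mx -[RHS](scaler0 _ (c%:C)%C) -P1.
  by rewrite scalemxAr scalemx_const mulr1.
have F0 : fourier_mx R m.+1 *m delta_mx 0 0 = const_mx 1 :> 'cV_m.+1.
  by apply/colP => i; rewrite -colE !mxE muln0.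
rewrite /PsiC -scalemxAl -!mulmxA -F0 mulKmx ?fourier_unit //.
rewrite (_ : diag_mx _ *m _ = 0) ?mulmx0 ?scaler0 //.
apply/colP => i; rewrite mul_diag_mx !mxE.
by case: eqP => [->|]; rewrite ?mulr0 // /psi min0n mul0r.
Qed.

(** * Sign of [K] at a solution of the system *)

Lemma dot_ge0 (R : realType) (n : nat) (x : 'cV[R]_n) : 0 <= dot x x.
Proof. by apply: sumr_ge0 => i _; rewrite -expr2 sqr_ge0. Qed.

Lemma norm2_dot (R : realType) (n : nat) (x : 'cV[R]_n) :
  norm2 x ^+ 2 = dot x x.
Proof. by rewrite /norm2 sqr_sqrtr ?dot_ge0. Qed.

(** Since L is symmetric, the quadratic part of [K] is 4 <L x, Psi x>. The equation replaces 4 Psi x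
    by v + (4/n) x ln x, and the cubic term of [K] supplies the - t^2 of g. *)
Lemma K_critical (R : realType) (n : nat) (x v : 'cV[R]_n) :
    4 *: (Psi R n *m x) - (4 / n%:R) *: (\col_j (x j 0 * ln (x j 0))) - v = 0 ->
  K x = 2 / n%:R * (\sum_(i < n)
          (2 * (x i 0 * ln (x i 0)) - x i 0 ^+ 2) * (lap R n *m x) i 0)
        + dot v (lap R n *m x).
Proof.
move=> /matrixP crit; rewrite /K -mulmxA dot_mulmxr lap_sym.
rewrite mulr_sumr mulr_sumr mulr_sumr -sumrB -big_split /=.
apply: eq_bigr => i _; have := crit i 0; rewrite !mxE.
set P := \sum_j _; set l := \sum_j _ => e.
have -> : v i 0 = 4 * P - 4 / n%:R * (x i 0 * ln (x i 0)) by lra.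
rewrite -!/l; ring.
Qed.

Lemma K_lt0_of_solution (R : realType) (n : nat) (x v : 'cV[R]_n) :
    4 *: (Psi R n *m x) - (4 / n%:R) *: (\col_j (x j 0 * ln (x j 0))) - v = 0 ->
    0 < norm2 x ^+ 2 -> norm2 x ^+ 2 < n%:R ->
    (forall j : 'I_n, [/\ 0 <= x j 0, x j 0 * v j 0 = 0 & 0 <= v j 0]) ->
  K x < 0.
Proof.
move=> crit x_gt0 x_lt sgn; rewrite ltNge; apply/negP => K_ge0.
have n_gt0 : (0 < n)%N by rewrite -(ltr0n R) (lt_trans x_gt0).
pose g (t : R) := 2 * (t * ln t) - t ^+ 2.
have g_decr (s t : R) : 0 <= s -> 0 <= t -> s != t -> (g s - g t) * (s - t) < 0.
  move=> s_ge0 t_ge0; rewrite neq_lt => /orP[st|ts].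
    by rewrite nmulr_llt0 ?subr_lt0 // subr_gt0; apply: xlnx_sub_sqr_decr.
  by rewrite pmulr_llt0 ?subr_gt0 // subr_lt0; apply: xlnx_sub_sqr_decr.
have g_le (i : 'I_n) :
    (g (x i 0) - g (x (ordS i) 0)) * (x i 0 - x (ordS i) 0) <= 0.
  have [->|ne] := eqVneq (x i 0) (x (ordS i) 0); first by rewrite !subrr mulr0.
  by apply/ltW/g_decr => //; [case: (sgn i) | case: (sgn (ordS i))].
have v_le : dot v (lap R n *m x) <= 0.
  apply: sumr_le0 => i _; rewrite lapE; case: (sgn i) => xi_ge0 xv v_ge0.
  (* As v_i x_i = 0, the diagonal term of (L x)_i drops out and only the neighbours remain, with a
     minus sign. *)
  rewrite (_ : _ * _ = v i 0 * - (x (ordS i) 0 + x (ord_pred i) 0)).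
    rewrite mulrN oppr_le0 mulr_ge0 // addr_ge0 //.
      by case: (sgn (ordS i)).
    by case: (sgn (ord_pred i)).
  rewrite -addrA -opprD mulrBr mulrCA mulrC.
  by rewrite [v i 0 * x i 0]mulrC xv mul0r mulrN sub0r mulrC.
(* A sum of nonpositive terms that is also nonnegative, so each term vanishes and neighbouring
   entries agree. *)
have sum0 : \sum_(i < n)
    (g (x i 0) - g (x (ordS i) 0)) * (x i 0 - x (ordS i) 0) = 0.
  apply/le_anti/andP; split; first by apply: sumr_le0 => i _; exact: g_le.
  move: K_ge0; rewrite (K_critical crit) (sum_mul_lap g) => K_ge0.
  have : 0 < 2 / n%:R :> R by rewrite divr_gt0 ?ltr0n.
  by move=> /pmulr_rge0 <-; lra.
have xS i : x (ordS i) 0 = x i 0.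
  apply/eqP; apply/negPn/negP; rewrite eq_sym => ne.
  have : (g (x i 0) - g (x (ordS i) 0)) * (x i 0 - x (ordS i) 0) < 0.
    by apply: g_decr => //; [case: (sgn i) | case: (sgn (ordS i))].
  suff -> : (g (x i 0) - g (x (ordS i) 0)) * (x i 0 - x (ordS i) 0) = 0.
    by rewrite ltxx.
  apply: oppr_inj; rewrite oppr0.
  apply: (psumr_eq0P (P := xpredT)
     (F := fun i : 'I_n => - ((g (x i 0) - g (x (ordS i) 0))
                              * (x i 0 - x (ordS i) 0)))) => //.
    by move=> j _; rewrite oppr_ge0.
  by rewrite sumrN sum0 oppr0.
have xc (i j : 'I_n) : x i 0 = x j 0.
  exact: (ordS_invariant (f := fun k => x k 0) xS).
pose i0 := Ordinal n_gt0; pose c := x i0 0.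
have xE : x = const_mx c by apply/colP => i; rewrite mxE (xc i i0).
have norm_x : norm2 x ^+ 2 = c ^+ 2 * n%:R.
  rewrite norm2_dot xE /dot; under eq_bigr do rewrite !mxE -expr2.
  by rewrite sumr_const card_ord mulr_natr.
have [c_ge0 cv v_ge0] := sgn i0; rewrite -/c in c_ge0 cv.
have c_gt0 : 0 < c.
  rewrite lt_neqAle c_ge0 andbT; apply: contraTneq x_gt0 => c0.
  by rewrite norm_x -c0 expr0n mul0r ltxx.
have c_lt1 : c < 1.
  move: x_lt; rewrite norm_x gtr_pMl ?ltr0n // => c2.
  by rewrite -(@expr_lt1 _ 2).
have v0 : v i0 0 = 0 by move/eqP: cv; rewrite mulf_eq0 gt_eqF //= => /eqP.
(* In row i0 both Psi x and v vanish, which leaves c ln c = 0 with 0 < c < 1. *)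
have /matrixP/(_ i0 0) := crit.
rewrite {1}xE Psi_const scaler0 sub0r !mxE -/c v0 subr0.
move/eqP; rewrite oppr_eq0 mulf_eq0 (gt_eqF (divr_gt0 _ _)) ?ltr0n //=.
by rewrite mulf_eq0 gt_eqF //= lt_eqF // ln_lt0 // c_gt0.
Qed.

(** * Tools for the variational argument: small perturbations and the energy *)

Lemma ge0_of_small_perturbation (R : realType) (a c e : R) : 0 < e ->
  (forall t, 0 < t -> t <= e -> 0 <= a + c * t) -> 0 <= a.
Proof.
move=> e_gt0 small; rewrite leNgt; apply/negP => a_lt0.
have c_gt0 : 0 < `|c| + 1 by rewrite ltr_wpDl.
(* This t satisfies c t <= - a / 2, whence a + c t <= a / 2 < 0. *)
pose t := Num.min e (- a / (2 * (`|c| + 1))).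
have t_gt0 : 0 < t by rewrite lt_min e_gt0 divr_gt0 ?oppr_gt0 ?mulr_gt0.
have te : t <= e by rewrite ge_min lexx.
have : t <= - a / (2 * (`|c| + 1)) by rewrite ge_min lexx orbT.
rewrite ler_pdivlMr ?mulr_gt0 //.
have : c * t <= (`|c| + 1) * t.
  by rewrite ler_pM2r // (le_trans (ler_norm c)) // lerDl.
have := small t t_gt0 te; lra.
Qed.

(** For A = n Psi, [energy A x] + |x|^2 ln (|x|^2 / n) is n (2 <x, Psi x> - H[x]); the logarithmic
    correction vanishes on the sphere |x|^2 = n. *)
Definition energy (R : realType) (n : nat) (A : 'M[R]_n) (x : 'cV[R]_n) : R :=
  2 * dot x (A *m x) - \sum_(i < n) x i 0 ^+ 2 * ln (x i 0 ^+ 2).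

Lemma dot_eq0 (R : realType) (n : nat) (x : 'cV[R]_n) :
  (dot x x == 0) = (x == 0).
Proof.
apply/eqP/eqP => [x0|->]; last by apply: big1 => i _; rewrite mxE mul0r.
apply/colP => i; rewrite mxE; apply/eqP; rewrite -sqrf_eq0 expr2.
by apply/eqP; apply: (psumr_eq0P _ x0) => // j _; rewrite -expr2 sqr_ge0.
Qed.

Lemma dotZ (R : realType) (n : nat) (s : R) (x y : 'cV[R]_n) :
  dot (s *: x) (s *: y) = s ^+ 2 * dot x y.
Proof. by rewrite mulr_sumr; apply: eq_bigr => i _; rewrite !mxE; ring. Qed.

Lemma energyZ (R : realType) (n : nat) (A : 'M[R]_n) (s : R) (x : 'cV[R]_n) :
  0 < s -> energy A (s *: x) = s ^+ 2 * (energy A x - ln (s ^+ 2) * dot x x).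
Proof.
move=> s_gt0; rewrite /energy -scalemxAr dotZ.
rewrite (_ : \sum_(i < n) _ = s ^+ 2 *
    (\sum_(i < n) x i 0 ^+ 2 * ln (x i 0 ^+ 2) + ln (s ^+ 2) * dot x x)).
  by ring.
rewrite mulr_sumr -big_split mulr_sumr; apply: eq_bigr => i _ /=.
(* The logarithm of a product splits only for positive factors; a zero coordinate contributes 0 to
   both sides. *)
rewrite !mxE; have [->|xi] := eqVneq (x i 0) 0.
  by rewrite !(mulr0, expr0n, mul0r, addr0).
have x2 : 0 < x i 0 ^+ 2 by rewrite lt_neqAle eq_sym sqrf_eq0 xi sqr_ge0.
have s2 : 0 < s ^+ 2 by rewrite exprn_gt0.
by rewrite exprMn lnM ?posrE //; ring.
Qed.

(** * Existence of a minimiser on the sphere in the orthant *)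

Lemma continuous_sum (T : topologicalType) (R : realType) (n : nat)
    (f : 'I_n -> T -> R) :
  (forall i, continuous (f i)) -> continuous (fun x => \sum_(i < n) f i x).
Proof.
move=> fc; apply: continuous_big => [|i _]; last exact: fc.
exact: add_continuous.
Qed.

(** The extreme value theorem is applied to row vectors, so functions of columns are composed with
    transposition. *)
Lemma coord_tr_continuous (R : realType) (n : nat) (i : 'I_n) :
  continuous (fun x : 'rV[R]_n => x^T i 0).
Proof. by under eq_fun do rewrite mxE; exact: coord_continuous. Qed.

Lemma continuous_mul (T : topologicalType) (R : realType) (f g : T -> R) :
  continuous f -> continuous g -> continuous (fun x => f x * g x).
Proof. by move=> fc gc x; apply: cvgM; [exact: fc | exact: gc]. Qed.

Lemma dot_tr_continuous (R : realType) (n : nat) (A : 'M[R]_n) :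
  continuous (fun x : 'rV[R]_n => dot x^T (A *m x^T)).
Proof.
apply: continuous_sum => i; apply: continuous_mul.
  exact: coord_tr_continuous.
under eq_fun do rewrite mxE; apply: continuous_sum => j.
apply: continuous_mul; last exact: coord_tr_continuous.
by move=> x; exact: cst_continuous.
Qed.

Lemma energy_continuous (R : realType) (n : nat) (A : 'M[R]_n) :
  continuous (fun x : 'rV[R]_n => energy A x^T).
Proof.
have f_cont : continuous (fun x : 'rV[R]_n => 2 * dot x^T (A *m x^T)).
  apply: continuous_mul; last exact: dot_tr_continuous.
  by move=> x; exact: cst_continuous.
have g_cont : continuous (fun x : 'rV[R]_n =>
    \sum_(i < n) x^T i 0 ^+ 2 * ln (x^T i 0 ^+ 2)).
  apply: continuous_sum => i x.
  apply: (@continuous_comp _ _ _ (fun z : 'rV[R]_n => z^T i 0)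
                                 (fun u : R => u ^+ 2 * ln (u ^+ 2))).
    exact: coord_tr_continuous.
  apply: (@continuous_comp _ _ _ (fun u : R => u ^+ 2) (fun u : R => u * ln u)).
    exact: exprn_continuous.
  exact: xlnx_continuous.
by move=> x; exact: (continuousB (f_cont x) (g_cont x)).
Qed.

Lemma energy_min_sphere (R : realType) (n : nat) (A : 'M[R]_n) : (0 < n)%N ->
  exists z : 'cV[R]_n, [/\ nonneg z, dot z z = n%:R &
    forall y, nonneg y -> dot y y = n%:R -> energy A z <= energy A y].
Proof.
move=> n_gt0.
pose S : set 'rV[R]_n := [set x | nonneg x^T /\ dot x^T x^T = n%:R].
have S0 : S !=set0.
  exists (const_mx 1); split; first by move=> i; rewrite !mxE.
  rewrite /dot; under eq_bigr do rewrite !mxE mulr1.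
  by rewrite sumr_const card_ord.
have S_closed : closed S.
  have -> : S = (\bigcap_(i in [set: 'I_n])
                   ((fun x : 'rV[R]_n => x^T i 0) @^-1` [set u | 0 <= u])) `&`
                ((fun x : 'rV[R]_n => dot x^T x^T) @^-1` [set n%:R]).
    apply/seteqP; split => x /= [x_ge0 x_norm]; split => // i.
      by move=> _; exact: x_ge0.
    exact: x_ge0.
  apply: closedI.
    apply: closed_bigI => i _; apply: closed_comp; last exact: closed_ge.
    by move=> x _; exact: coord_tr_continuous.
  apply: closed_comp; last exact: closed_eq.
  move=> x _; have := @dot_tr_continuous R n 1%:M x.
  by under eq_fun do rewrite mul1mx.
(* From |x_j|^2 <= n <= n^2, the number n itself bounds the max norm. *)
have S_bounded : bounded_set S.
  exists n%:R; split; first exact: num_real.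
  move=> M nM x [_ x_norm]; apply: ltW; apply: le_lt_trans nM.
  rewrite [leLHS]/Num.norm /= mx_normrE.
  apply/bigmax_leP; split => //= -[i j] _ /=.
  rewrite ord1 -(@ler_pXn2r _ 2) ?nnegrE // real_normK ?num_real //.
  have : x 0 j ^+ 2 <= n%:R.
    rewrite -x_norm /dot (bigD1 j) //= !mxE -expr2 lerDl.
    by apply: sumr_ge0 => k _; rewrite -expr2 sqr_ge0.
  move=> /le_trans; apply; rewrite expr2 ler_pMr ?ltr0n // ler1n //.
have [z] := EVT_min_rV S0 (bounded_closed_compact S_bounded S_closed)
  (continuous_subspaceT (@energy_continuous R n A)).
rewrite inE => -[z_ge0 z_norm] z_min; exists z^T; split => // y y_ge0 y_norm.
by rewrite -[y]trmxK; apply: z_min; rewrite inE /S /= trmxK.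
Qed.

(** * First-order conditions by one-coordinate perturbations *)

(** The expansion is exact in t: symmetry of A merges the two cross terms, and only the j-th
    logarithmic term changes. *)
Lemma energy_delta (R : realType) (n : nat) (A : 'M[R]_n) (x : 'cV[R]_n)
    (j : 'I_n) (t : R) : A^T = A ->
  energy A (x + t *: delta_mx j 0) =
  energy A x + 4 * t * (A *m x) j 0 + 2 * t ^+ 2 * A j j
  - ((x j 0 + t) ^+ 2 * ln ((x j 0 + t) ^+ 2)
     - x j 0 ^+ 2 * ln (x j 0 ^+ 2)).
Proof.
move=> A_sym; set d := t *: delta_mx j 0.
have dE i : d i 0 = t *+ (i == j) by rewrite !mxE eqxx andbT mulr_natr.
have dot_d (y : 'cV_n) : dot d y = t * y j 0.
  rewrite /dot (bigD1 j) //= big1 ?addr0 ?dE ?eqxx // => i /negPf ij.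
  by rewrite dE ij mul0r.
have dotDl (y1 y2 y3 : 'cV[R]_n) : dot (y1 + y2) y3 = dot y1 y3 + dot y2 y3.
  by rewrite !dotE linearD mulmxDl mxE.
have dotDr (y1 y2 y3 : 'cV[R]_n) : dot y3 (y1 + y2) = dot y3 y1 + dot y3 y2.
  by rewrite !dotE mulmxDr mxE.
have quad : dot (x + d) (A *m (x + d))
          = dot x (A *m x) + 2 * t * (A *m x) j 0 + t ^+ 2 * A j j.
  rewrite mulmxDr dotDl !dotDr.
  have -> : dot x (A *m d) = dot d (A *m x) by rewrite dot_mulmxr A_sym dotC.
  rewrite !dot_d.
  have -> : (A *m d) j 0 = t * A j j.
    by rewrite -[A]trmxK A_sym -scalemxAr -colE !mxE.
  ring.
have xdE i : (x + d) i 0 = x i 0 + t *+ (i == j) by rewrite mxE dE.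
rewrite /energy quad.
rewrite (bigD1 j) //= [in RHS](bigD1 j) //= xdE eqxx mulr1n.
under eq_bigr => i /negPf ij do rewrite xdE ij mulr0n addr0.
ring.
Qed.

(** This is ln y <= y - 1 at y = q / q0, with q (q / q0 - 1) expanded about q0 to isolate the linear
    part. *)
Lemma mul_ln_ratio_le (R : realType) (q q0 : R) : 0 < q0 -> 0 <= q ->
  q * ln (q / q0) <= (q - q0) + (q - q0) ^+ 2 / q0.
Proof.
move=> q0_gt0 q_ge0; rewrite (_ : _ + _ = q * (q / q0 - 1)); last first.
  by field; rewrite gt_eqF.
have [->|q_neq0] := eqVneq q 0; first by rewrite !mul0r.
have q_gt0 : 0 < q by rewrite lt_neqAle eq_sym q_neq0.
rewrite ler_pM2l // -[X in ln X](subrKC 1) le_ln1Dx //.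
by rewrite ltrBrDl subrr divr_gt0.
Qed.

(* Moving the coordinate x_j by t changes dot x x by w := 2 x_j t + t^2. *)
Lemma energy_first_order (R : realType) (n : nat) (A : 'M[R]_n)
    (x : 'cV[R]_n) (j : 'I_n) (t : R) :
  A^T = A -> nonneg x -> 0 < dot x x -> energy A x = 0 ->
  (forall y, nonneg y -> 0 <= energy A y + dot y y * ln (dot y y / dot x x)) ->
  0 <= x j 0 + t ->
  (x j 0 + t) ^+ 2 * ln ((x j 0 + t) ^+ 2) - x j 0 ^+ 2 * ln (x j 0 ^+ 2) <=
  4 * t * (A *m x) j 0 + 2 * t ^+ 2 * A j j + (2 * x j 0 * t + t ^+ 2)
  + (2 * x j 0 * t + t ^+ 2) ^+ 2 / dot x x.
Proof.
move=> A_sym x_ge0 xx_gt0 Ex0 E_ge0 xjt.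
have y_ge0 : nonneg (x + t *: delta_mx j 0).
  move=> i; rewrite !mxE eqxx andbT; case: eqP => [->|_].
    by rewrite mulr1.
  by rewrite mulr0 addr0.
have yy : dot (x + t *: delta_mx j 0) (x + t *: delta_mx j 0)
        = dot x x + (2 * x j 0 * t + t ^+ 2).
  rewrite /dot (bigD1 j) //= [in RHS](bigD1 j) //= !mxE !eqxx mulr1.
  under eq_bigr => i /negPf ij do rewrite !mxE ij mulr0 addr0.
  ring.
have := E_ge0 _ y_ge0; rewrite energy_delta // Ex0.
have := mul_ln_ratio_le xx_gt0 (dot_ge0 (x + t *: delta_mx j 0)).
rewrite yy [dot x x + _ - _]addrAC subrr add0r.
lra.
Qed.

(** A coordinate x_j > 0 can move both ways, so the coefficient of t vanishes; at x_j = 0 only t >=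
    0 is admissible, which gives a sign only. *)
Lemma energy_kkt (R : realType) (n : nat) (A : 'M[R]_n) (x : 'cV[R]_n)
    (j : 'I_n) :
  A^T = A -> nonneg x -> 0 < dot x x -> energy A x = 0 ->
  (forall y, nonneg y -> 0 <= energy A y + dot y y * ln (dot y y / dot x x)) ->
  0 <= (A *m x) j 0 - x j 0 * ln (x j 0)
  /\ x j 0 * ((A *m x) j 0 - x j 0 * ln (x j 0)) = 0.
Proof.
move=> A_sym x_ge0 xx_gt0 Ex0 E_ge0.
have fo t := energy_first_order (t := t) (j := j) A_sym x_ge0 xx_gt0 Ex0 E_ge0.
set b : R := (A *m x) j 0 in fo *; set q := dot x x in xx_gt0 fo *.
have := x_ge0 j; rewrite le_eqVlt => /orP[/eqP xj0|xj_gt0].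
  rewrite -xj0 !mul0r subr0; split=> //.
  suff : 0 <= 4 * b by lra.
  (* After division by t = s^2 the other terms are O(s) for s <= 1; in the 5, the logarithm accounts
     for 4 and the growth of [dot x x] for 1. *)
  apply: (@ge0_of_small_perturbation _ _ (2 * `|A j j| + 5 + q^-1) 1) => //.
  move=> s s_gt0 s_le1.
  (* With t = s^2 the singular term is harmless: - t^2 ln t^2 <= 4 s^3. *)
  have := fo (s ^+ 2); rewrite -xj0 !add0r expr0n mul0r subr0 mulr0 mul0r add0r.
  move=> /(_ (sqr_ge0 s)).
  have ln_s : - ln s <= s^-1.
    by rewrite -lnV ?posrE // ltW // ln_sublinear // invr_gt0.
  rewrite -!exprM lnXn //.
  have s2_gt0 : 0 < s ^+ 2 by rewrite exprn_gt0.
  move=> fo_s; have {fo_s} : s ^+ 2 * (s ^+ 2 * (4 * ln s)) <=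
      s ^+ 2 * (4 * b + 2 * s ^+ 2 * A j j + s ^+ 2 + s ^+ 6 / q).
    by move: fo_s; congr (is_true (_ <= _)); ring.
  rewrite ler_pM2l // => fo_s.
  have sX k : (0 < k)%N -> s ^+ k <= s.
    by move=> k_gt0; rewrite ler_iXnr // ltW.
  have s_ln : s * (s * - ln s) <= s * 1.
    by rewrite ler_pM2l // -(divff (lt0r_neq0 s_gt0)) ler_pM2l.
  have s6 : s ^+ 6 / q <= q^-1 * s by rewrite mulrC ler_pM2l ?invr_gt0 ?sX.
  have sA : A j j * s ^+ 2 <= `|A j j| * s.
    apply: (@le_trans _ _ (`|A j j| * s ^+ 2)).
      by rewrite ler_pM2r ?ler_norm.
    by rewrite ler_wpM2l ?sX.
  have := sX 2 isT; lra.
suff a0 : b - x j 0 * ln (x j 0) = 0 by rewrite a0 mulr0 lexx.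
set X : R := x j 0 in xj_gt0 fo *.
(* The t^2 terms, with (2 X + t)^2 <= (2 X + 1)^2 in the remainder. The 1 in the tangent slope 1 +
   ln X^2 cancels against the increment 2 X t + t^2 of [dot x x]. *)
pose C := 2 * A j j - ln (X ^+ 2) + (2 * X + 1) ^+ 2 / q.
have pert (t : R) : `|t| <= Num.min 1 X ->
    0 <= t * (4 * (b - X * ln X)) + C * t ^+ 2.
  rewrite le_min => /andP[t1 tX].
  have Xt : 0 <= X + t by move: tX; rewrite ler_norml; lra.
  have X2 : 0 < X ^+ 2 by rewrite exprn_gt0.
  have := xlnx_tangent (sqr_ge0 (X + t)) X2.
  have lnX2 : ln (X ^+ 2) = 2 * ln X by rewrite lnXn // mulr_natl.
  have := fo t Xt; rewrite /C lnX2.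
  have : (2 * X * t + t ^+ 2) ^+ 2 / q <= (2 * X + 1) ^+ 2 / q * t ^+ 2.
    rewrite [leRHS]mulrAC ler_pM2r ?invr_gt0 //.
    rewrite (_ : (_ + _) ^+ 2 = (2 * X + t) ^+ 2 * t ^+ 2); last by ring.
    move: t1; rewrite ler_norml => /andP[_ t1].
    rewrite ler_wpM2r ?sqr_ge0 // ler_pXn2r ?nnegrE //; lra.
  lra.
have m_gt0 : 0 < Num.min 1 X by rewrite lt_min ltr01.
suff : 4 * (b - X * ln X) = 0 by lra.
apply/le_anti/andP; split.
  rewrite -oppr_ge0.
  apply: (ge0_of_small_perturbation (c := C) m_gt0) => t t_gt0 tm.
  have := pert (- t); rewrite normrN gtr0_norm // => /(_ tm) h.
  by rewrite -(pmulr_rge0 _ t_gt0); lra.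
apply: (ge0_of_small_perturbation (c := C) m_gt0) => t t_gt0 tm.
have := pert t; rewrite gtr0_norm // => /(_ tm) h.
by rewrite -(pmulr_rge0 _ t_gt0); lra.
Qed.

(** * Rescaling the minimiser, and the theorem *)

Lemma energy0 (R : realType) (n : nat) (A : 'M[R]_n) : energy A 0 = 0.
Proof.
rewrite /energy /dot !big1 ?mulr0 ?subrr // => i _.
  by rewrite !mxE expr0n mul0r.
by rewrite mxE mul0r.
Qed.

(* Rescaling the minimiser z on the sphere of squared radius n by exp(m/2),
   where energy A z = m n, removes the Lagrange multiplier; m < 0 puts the
   result strictly inside the ball. *)
Lemma energy_rescaled_min (R : realType) (n : nat) (A : 'M[R]_n)
    (x : 'cV[R]_n) :
  (0 < n)%N -> nonneg x ->
  energy A x + dot x x * ln (dot x x / n%:R) < 0 ->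
  exists w : 'cV[R]_n,
    [/\ nonneg w, 0 < dot w w, dot w w < n%:R, energy A w = 0 &
     forall y, nonneg y -> 0 <= energy A y + dot y y * ln (dot y y / dot w w)].
Proof.
move=> n_gt0 x_ge0 x_lt0; have nR : 0 < n%:R :> R by rewrite ltr0n.
have [z [z_ge0 zz z_min]] := energy_min_sphere A n_gt0.
pose m := energy A z / n%:R.
have Ez : energy A z = m * n%:R by rewrite /m divfK ?gt_eqF.
(* Scaling y onto the sphere, by s^2 = n / |y|^2, extends the minimality of z to the whole
   orthant. *)
have E_ge y : nonneg y ->
    m * dot y y <= energy A y + dot y y * ln (dot y y / n%:R).
  move=> y_ge0; have [yy0|yy_neq0] := eqVneq (dot y y) 0.
    move/eqP: (yy0); rewrite dot_eq0 yy0 mulr0 mul0r addr0 => /eqP ->.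
    by rewrite energy0.
  have yy : 0 < dot y y by rewrite lt_neqAle eq_sym yy_neq0 dot_ge0.
  pose s := Num.sqrt (n%:R / dot y y).
  have s_gt0 : 0 < s by rewrite sqrtr_gt0 divr_gt0.
  have s2 : s ^+ 2 = n%:R / dot y y by rewrite sqr_sqrtr // ltW // divr_gt0.
  have sy_ge0 : nonneg (s *: y).
    by move=> i; rewrite mxE; exact: mulr_ge0 (ltW s_gt0) (y_ge0 i).
  have := z_min _ sy_ge0; rewrite dotZ s2 divfK // => /(_ erefl).
  rewrite energyZ // s2 Ez [m * _]mulrC -mulrA ler_pM2l // ler_pdivlMl //.
  by rewrite -[n%:R / _]invf_div lnV ?posrE ?divr_gt0 //; lra.
have xx_gt0 : 0 < dot x x.
  rewrite lt_neqAle eq_sym dot_ge0 andbT; apply: contraTneq x_lt0 => xx0.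
  move/eqP: (xx0); rewrite dot_eq0 xx0 mul0r addr0 => /eqP ->.
  by rewrite energy0 ltxx.
have m_lt0 : m < 0.
  by have := le_lt_trans (E_ge x x_ge0) x_lt0; rewrite pmulr_llt0.
have s_gt0 := expR_gt0 (m / 2).
have s2 : expR (m / 2) ^+ 2 = expR m.
  by rewrite -expRM_natl; congr expR; field.
have ww : dot (expR (m / 2) *: z) (expR (m / 2) *: z) = expR m * n%:R.
  by rewrite dotZ s2 zz.
exists (expR (m / 2) *: z); rewrite ww; split.
- by move=> i; rewrite mxE; exact: mulr_ge0 (expR_ge0 _) (z_ge0 i).
- by rewrite mulr_gt0 ?expR_gt0.
- by rewrite gtr_pMl // expR_lt1.
- by rewrite energyZ // s2 expRK zz Ez subrr mulr0.
move=> y y_ge0; have := E_ge y y_ge0.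
have [->|yy_neq0] := eqVneq (dot y y) 0; first by rewrite !mul0r mulr0.
have yy : 0 < dot y y by rewrite lt_neqAle eq_sym yy_neq0 dot_ge0.
(* Here ln (|y|^2 / (e^m n)) = ln (|y|^2 / n) - m, which absorbs the term m |y|^2 of [E_ge]. *)
move=> y_min; rewrite [expR m * _]mulrC invfM mulrA.
rewrite ln_div ?posrE ?divr_gt0 ?expR_gt0 //.
by rewrite expRK; lra.
Qed.

Theorem theorem3p1 (R : realType) (n : nat) (n_gt0 : (0 < n)%N)
    (K_ge0 : forall x : 'cV[R]_n,
      nonneg x -> 0 < norm2 x ^+ 2 -> norm2 x ^+ 2 < n%:R -> 0 <= K x) :
  (~ exists (x : 'cV[R]_n) (v : 'cV[R]_n),
      [/\ 4 *: (Psi R n *m x)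
            - (4 / n%:R) *: (\col_j (x j 0 * ln (x j 0))) - v = 0,
          0 < norm2 x ^+ 2,
          norm2 x ^+ 2 < n%:R &
          forall j : 'I_n, [/\ 0 <= x j 0, x j 0 * v j 0 = 0 & 0 <= v j 0]])
  /\ (forall x : 'cV[R]_n,
        nonneg x -> x <> 0 -> entropy x <= 2 * dot x (Psi R n *m x)).
Proof.
have nR : 0 < n%:R :> R by rewrite ltr0n.
split=> [[x [v [crit x_gt0 x_lt sgn]]]|x x_ge0 x_neq0].
  have := K_lt0_of_solution crit x_gt0 x_lt sgn; rewrite ltNge K_ge0 //.
  by move=> j; case: (sgn j).
rewrite leNgt; apply/negP => x_lt.
pose A := n%:R *: Psi R n.
have A_sym : A^T = A by rewrite /A linearZ /= Psi_sym.
have : energy A x + dot x x * ln (dot x x / n%:R) < 0.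
  have n1 : 0 < n%:R^-1 :> R by rewrite invr_gt0.
  rewrite -(pmulr_llt0 _ n1).
  rewrite [ltLHS](_ : _ = 2 * dot x (Psi R n *m x) - entropy x) ?subr_lt0 //.
  rewrite /entropy norm2_dot /energy /A -scalemxAl.
  rewrite [dot x (n%:R *: _)]dotE -scalemxAr mxE -dotE.
  by field; rewrite gt_eqF.
move=> /(energy_rescaled_min n_gt0 x_ge0) [w [w_ge0 ww_gt0 ww_lt Ew0 E_ge]].
suff : K w < 0 by rewrite ltNge K_ge0 ?norm2_dot.
(* The multiplier is defined by the equation itself; [energy_kkt] provides its sign and
   complementary slackness. *)
apply: (@K_lt0_of_solution _ _ _
  (\col_j (4 / n%:R * ((A *m w) j 0 - w j 0 * ln (w j 0)))));
  rewrite ?norm2_dot //.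
  by apply/colP => j; rewrite /A -scalemxAl !mxE; field; rewrite gt_eqF.
move=> j; have [v_ge0 wv] := energy_kkt j A_sym w_ge0 ww_gt0 Ew0 E_ge.
by rewrite mxE mulrCA wv mulr0; split; rewrite // mulr_ge0 // divr_ge0.
Qed.
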